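(* Let $X=(\{0\}\times\mathbb{Z})\cup(\mathbb{Z}\times\{0\})\cup\{(n,\pm n)\mid n\in\mathbb{Z}\}$, regarded as a metric subspace of $\mathbb{Z}^2$. Then $\mathbb{Z}$ and $X$ are not coarsely equivalent, but there exists an ordered Banach space isomorphism between $\mathrm{C}^*_u(\mathbb{Z})$ and $\mathrm{C}^*_u(X)$. In particular, $\mathrm{C}^{*,r}_u(\mathbb{Z})$ and $\mathrm{C}^{*,r}_u(X)$ are isomorphic as Banach lattices.
   Context: $\mathbb{Z}$ and $\mathbb{Z}^2$ carry their usual metrics. For a countable uniformly locally finite metric space $(X,d)$ (i.e. $\sup_{x\in X}|B_r(x)|<\infty$ for every $r>0$), let $(\delta_x)_{x\in X}$ be the standard basis of the complex Hilbert space $\ell_2(X)$. An operator $a\in\mathcal{L}(\ell_2(X))$ is a band operator if there is $r>0$ with $\langle a\delta_x,\delta_y\rangle=0$ whenever $d(x,y)>r$. $\mathrm{C}^*_u(X)$ is the operator-norm closure of the algebra of band operators. Order: $a\in\mathcal{L}(\ell_2(X))$ is positive if it maps vectors with nonnegative coordinates to vectors with nonnegative coordinates (not the $\mathrm{C}^*$-algebraic order); $\mathrm{C}^*_u(X)$ inherits this order. An ordered Banach space isomorphism is a bounded linear bijection with bounded inverse such that it and its inverse both map positive elements to positive elements. Regular version: for $a\in\mathcal{L}(\ell_2(X))$ write $a=a_r+ia_c$ on the real Hilbert space $\ell_2(X;\mathbb{R})$, with $a_r,a_c\in\mathcal{L}(\ell_2(X;\mathbb{R}))$; $a$ is regular if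 $a_r$ and $a_c$ are each a difference of two positive linear maps. For regular $a$, $|a|=\sup_{t\in[0,2\pi]}|\cos(t)a_r+\sin(t)a_c|$ (supremum in the Dedekind complete vector lattice of regular operators on $\ell_2(X;\mathbb{R})$) and $\|a\|_r=\||a|\|$. All band operators are regular, and $\mathrm{C}^{*,r}_u(X)$ is the $\|\cdot\|_r$-closure of the band operators in the space of regular operators; it is a complex Banach lattice with norm $\|\cdot\|_r$ and modulus $|\cdot|$. An isomorphism of Banach lattices is a linear homeomorphic bijection $\Psi$ with $|\Psi(a)|=\Psi(|a|)$ for all $a$. A map $f:(X,d)\to(Y,\partial)$ is coarse if for all $r>0$ there is $s>0$ such that $d(x,y)<r$ implies $\partial(f(x),f(y))<s$; expanding if for all $s>0$ there is $r>0$ such that $d(x,y)>r$ implies $\partial(f(x),f(y))>s$; a coarse equivalence if it is coarse, expanding and $\sup_{y\in Y}\partial(y,f(X))<\infty$. Two spaces are coarsely equivalent if there is a coarse equivalence between them. *)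

(* Defs.v *)
From HB Require Import structures.
From mathcomp Require Import all_boot all_order all_algebra.
From mathcomp Require Import all_classical all_reals all_analysis.
From mathcomp Require Import complex.
From mathcomp Require Import ring lra.

Set Implicit Arguments.
Unset Strict Implicit.
Unset Printing Implicit Defensive.

Import Order.TTheory GRing.Theory Num.Theory.

Local Open Scope classical_set_scope.
Local Open Scope ring_scope.

Section Coarse.
Context {R : realType} {X Y : metricType R}.
Implicit Type f : X -> Y.

Definition coarse f := forall r : R, 0 < r -> exists2 s : R, 0 < s &
  forall x y : X, mdist x y < r -> mdist (f x) (f y) < s.

Definition expanding f := forall s : R, 0 < s -> exists2 r : R, 0 < r &
  forall x y : X, r < mdist x y -> s < mdist (f x) (f y).

Definition dist_to_image f (y : Y) : \bar R :=
  ereal_inf (range (fun x => (mdist y (f x))%:E)).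

Definition coarse_equivalence f :=
  [/\ coarse f, expanding f & (ereal_sup (range (dist_to_image f)) < +oo)%E].

End Coarse.

Definition coarsely_equivalent (R : realType) (X Y : metricType R) :=
  exists f : X -> Y, coarse_equivalence f.

(* A metric structure on a type determines its topology, so the instances
   below live on aliases that remember [R]. *)
Definition Zline (R : realType) : Type := int.

Section Zline.
Context (R : realType).

HB.instance Definition _ := Choice.copy (Zline R) int.

Definition dist_int (m n : int) : R := `|m - n|%:~R.

Let distxx (m : Zline R) : dist_int m m = 0.
Proof. by rewrite /dist_int subrr normr0. Qed.

Let dist_eq0 (m n : Zline R) : dist_int m n = 0 -> m = n.
Proof.
move/eqP; rewrite /dist_int intr_eq0 normr_eq0 subr_eq0 => /eqP; exact.
Qed.

Let distC (m n : Zline R) : dist_int m n = dist_int n m.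
Proof. by rewrite /dist_int distrC. Qed.

Let dist_tri (n m p : Zline R) : dist_int m p <= dist_int m n + dist_int n p.
Proof. by rewrite /dist_int -intrD ler_int ler_distD. Qed.

HB.instance Definition _ :=
  isMetric.Build R (Zline R) distxx dist_eq0 distC dist_tri.

End Zline.

Definition in_star (p : int * int) : bool :=
  [|| p.1 == 0, p.2 == 0, p.2 == p.1 | p.2 == - p.1].

Definition star (R : realType) : Type := {p : int * int | in_star p}.

Section Star.
Context (R : realType).

HB.instance Definition _ :=
  Choice.copy (star R) {p : int * int | in_star p}.

(* The Euclidean metric of the plane, restricted to the integer points. *)
Definition dist_plane (p q : int * int) : R :=
  Num.sqrt (((p.1 - q.1) ^+ 2 + (p.2 - q.2) ^+ 2)%:~R).

Definition dist_star (p q : star R) : R := dist_plane (val p) (val q).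

Let distxx (p : star R) : dist_star p p = 0.
Proof. by rewrite /dist_star /dist_plane !subrr sqrtr0. Qed.

Let dist_eq0 (p q : star R) : dist_star p q = 0 -> p = q.
Proof.
move/eqP; rewrite /dist_star /dist_plane sqrtr_eq0 lerz0 => h.
have : ((val p).1 - (val q).1) ^+ 2 + ((val p).2 - (val q).2) ^+ 2 == 0.
  by rewrite eq_le h addr_ge0// sqr_ge0.
rewrite paddr_eq0 ?sqr_ge0// !sqrf_eq0 !subr_eq0 => /andP[/eqP h1 /eqP h2].
apply: val_inj; move: h1 h2; case: (val p) => a b; case: (val q) => c d /=.
by move=> -> ->.
Qed.

Let distC (p q : star R) : dist_star p q = dist_star q p.
Proof.
by rewrite /dist_star /dist_plane -(sqrrN (_.1 - _)) -(sqrrN (_.2 - _)) !opprB.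
Qed.

Let minkowski (a b c d : R) :
  Num.sqrt ((a + c) ^+ 2 + (b + d) ^+ 2) <=
  Num.sqrt (a ^+ 2 + b ^+ 2) + Num.sqrt (c ^+ 2 + d ^+ 2).
Proof.
have := le_normcD (Complex a b) (Complex c d).
by rewrite /ComplexField.Normc.normc /=.
Qed.

Let dist_tri (q p r : star R) : dist_star p r <= dist_star p q + dist_star q r.
Proof.
have E (u w : star R) : dist_star u w =
   Num.sqrt (((val u).1 - (val w).1)%:~R ^+ 2 +
             ((val u).2 - (val w).2)%:~R ^+ 2).
  by rewrite /dist_star /dist_plane !expr2 -!intrM -intrD.
rewrite !E; apply: le_trans (minkowski _ _ _ _).
by rewrite -!intrD !subrKA.
Qed.

HB.instance Definition _ :=
  isMetric.Build R (star R) distxx dist_eq0 distC dist_tri.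

End Star.

(* The norm of [R[i]] takes its values in [R[i]]; an [absval] is [R]-valued, so
   that the real and the complex l2 spaces have norms in the same field. *)
Record absval (R : realType) (K : numFieldType) := Absval {
  abs_fun :> K -> R ;
  abs_ge0 : forall z, 0 <= abs_fun z ;
  abs_eq0 : forall z, (abs_fun z == 0) = (z == 0) ;
  absD : forall z w, abs_fun (z + w) <= abs_fun z + abs_fun w ;
  absM : forall z w, abs_fun (z * w) = abs_fun z * abs_fun w }.

Section Instances.
Context (R : realType).

Definition real_abs : absval R R :=
  @Absval R R Num.norm (@normr_ge0 _ _) (@normr_eq0 _ _) (@ler_normD _ _)
    (@normrM _).

Local Notation normc := (@ComplexField.Normc.normc R).

Let normc_ge0 (z : R[i]) : 0 <= normc z.
Proof. by case: z => a b; exact: sqrtr_ge0. Qed.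

Let normc_eq0 (z : R[i]) : (normc z == 0) = (z == 0).
Proof.
apply/eqP/eqP => [/ComplexField.Normc.eq0_normc//|->].
exact: ComplexField.Normc.normc0.
Qed.

Definition complex_abs : absval R R[i] :=
  @Absval R R[i] normc normc_ge0 normc_eq0 (@le_normcD R)
    (@ComplexField.Normc.normcM R).

End Instances.

Section L2.
Context {R : realType} {K : numFieldType} (v : absval R K) (X : choiceType).

Definition square_summable : {pred X -> K^o} :=
  fun f => (\esum_(x in [set: X]) (v (f x) ^+ 2)%:E < +oo)%E.

Record l2 := L2 { l2_fun :> X -> K^o ; l2P : l2_fun \in square_summable }.

HB.instance Definition _ := [isSub for l2_fun].
HB.instance Definition _ := [Choice of l2 by <:].

Let abs0 : v 0 = 0.
Proof. by apply/eqP; rewrite abs_eq0. Qed.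

Let square_absD z w : v (z + w) ^+ 2 <= 2 * v z ^+ 2 + 2 * v w ^+ 2.
Proof.
have h : v (z + w) ^+ 2 <= (v z + v w) ^+ 2.
  by rewrite ler_sqr ?nnegrE ?absD ?addr_ge0 ?abs_ge0.
apply: (le_trans h); rewrite -subr_ge0.
have -> : 2 * v z ^+ 2 + 2 * v w ^+ 2 - (v z + v w) ^+ 2 = (v z - v w) ^+ 2.
  by ring.
exact: sqr_ge0.
Qed.

Let esum_scale_lty (c : R) (f : X -> \bar R) : 0 <= c ->
  (forall x, 0 <= f x)%E -> (\esum_(x in [set: X]) f x < +oo)%E ->
  (\esum_(x in [set: X]) (c%:E * f x) < +oo)%E.
Proof.
move=> c0 f0 foo.
apply: (@le_lt_trans _ _ (c%:E * \esum_(x in [set: X]) f x)%E); last first.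
  by rewrite lte_mul_pinfty.
apply: ge_ereal_sup => _ [A [finA AT] <-].
rewrite -ge0_mule_fsumr//; apply: lee_wpmul2l; rewrite ?lee_fin//.
by apply: ereal_sup_ubound; exists A.
Qed.

Lemma square_summable_submod : submod_closed square_summable.
Proof.
split=> [|c f g fs gs]; rewrite !unfold_in.
  rewrite (_ : \esum_(x in _) _ = 0%E) ?ltry//.
  by apply: esum1 => x _; rewrite abs0 expr0n.
apply: (@le_lt_trans _ _ (\esum_(x in [set: X])
  ((2 * v c ^+ 2)%:E * (v (f x) ^+ 2)%:E + 2%:E * (v (g x) ^+ 2)%:E))%E).
  apply: le_esum => x _; rewrite -!EFinM -EFinD lee_fin.
  by apply: (le_trans (square_absD _ _)); rewrite absM exprMn mulrA.
have sq0 z : (0 <= (v z ^+ 2)%:E)%E by rewrite lee_fin sqr_ge0.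
have c0 : 0 <= 2 * v c ^+ 2 by rewrite mulr_ge0 ?sqr_ge0.
rewrite esumD//; last 2 first.
- by move=> x _; rewrite mule_ge0.
- by move=> x _; rewrite mule_ge0.
by apply: lte_add_pinfty; exact: esum_scale_lty.
Qed.

HB.instance Definition _ := GRing.isSubmodClosed.Build K (X -> K^o)
  square_summable square_summable_submod.
HB.instance Definition _ := [SubChoice_isSubLmodule of l2 by <:].

Definition l2norm (f : l2) : R :=
  Num.sqrt (fine (\esum_(x in [set: X]) (v (f x) ^+ 2)%:E)).

Let delta_fun (x : X) : X -> K^o := fun y => (y == x)%:R.

Let delta_subproof x : delta_fun x \in square_summable.
Proof.
rewrite unfold_in (esumID [set x]); last by move=> y _; rewrite lee_fin sqr_ge0.
rewrite setTI (_ : \esum_(y in setT `&` _) _ = 0%E).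
  by rewrite adde0 esum_set1 ?ltry// lee_fin sqr_ge0.
apply: esum1 => y [_ /eqP yx]; rewrite /delta_fun.
by move: yx => /negPf ->; rewrite abs0 expr0n.
Qed.

Definition l2delta (x : X) : l2 := L2 (delta_subproof x).

Implicit Type a : l2 -> l2.

Definition bounded_operator a : Prop :=
  linear a /\ exists M : R, forall f, l2norm (a f) <= M * l2norm f.

Definition opnorm a : R := sup [set l2norm (a f) | f in [set f | l2norm f <= 1]].

(* In [R[i]], [0 <= z] means that [z] is real and nonnegative. *)
Definition positive_operator a : Prop :=
  forall f : l2, (forall x, (0 : K) <= f x) -> forall x, (0 : K) <= a f x.

End L2.

Arguments square_summable {R K} v {X}.
Arguments l2delta {R K} v {X} x.
Arguments opnorm {R K v X} a.
Arguments bounded_operator {R K v X} a.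

Definition norm_closure (R : realType) (V : zmodType) (N : V -> R)
  (E A : set V) : set V :=
  [set a | E a /\ forall e : R, 0 < e -> exists2 b, A b & N (a - b) < e].

Notation l2R R := (l2 (real_abs R)).
Notation l2C R := (l2 (complex_abs R)).

Section Roe.
Context {R : realType} (X : metricType R).

(* [a (l2delta (complex_abs R) x) y] is the inner product of [a delta_x] and [delta_y]. *)
Definition band_operator : set (l2C R X -> l2C R X) :=
  [set a | bounded_operator a /\ exists2 r : R, 0 < r &
    forall x y : X, r < mdist x y -> a (l2delta (complex_abs R) x) y = 0].

Definition roe_algebra : set (l2C R X -> l2C R X) :=
  norm_closure opnorm bounded_operator band_operator.

End Roe.

Arguments band_operator {R} X a.
Arguments roe_algebra {R} X a.

Section ComplexVectors.
Context {R : realType} {X : choiceType}.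

Let re_subproof (f : l2C R X) :
  (fun x => complex.Re (f x)) \in square_summable (real_abs R).
Proof.
have := l2P f; rewrite !unfold_in; apply: le_lt_trans.
apply: le_esum => x _; rewrite lee_fin /=; case: (f x) => a b /=.
rewrite sqr_sqrtr ?addr_ge0 ?sqr_ge0// real_normK ?num_real//.
by rewrite lerDl sqr_ge0.
Qed.

Let im_subproof (f : l2C R X) :
  (fun x => complex.Im (f x)) \in square_summable (real_abs R).
Proof.
have := l2P f; rewrite !unfold_in; apply: le_lt_trans.
apply: le_esum => x _; rewrite lee_fin /=; case: (f x) => a b /=.
rewrite sqr_sqrtr ?addr_ge0 ?sqr_ge0// real_normK ?num_real//.
by rewrite lerDr sqr_ge0.
Qed.

Let complex_subproof (f g : l2R R X) :
  (fun x => Complex (f x) (g x)) \in square_summable (complex_abs R).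
Proof.
have := l2P f; have := l2P g; rewrite !unfold_in => gs fs.
rewrite (eq_esum (b := fun x =>
  ((real_abs R (f x) ^+ 2)%:E + (real_abs R (g x) ^+ 2)%:E)%E)).
  rewrite esumD; first exact: lte_add_pinfty.
    by move=> x _; rewrite lee_fin sqr_ge0.
  by move=> x _; rewrite lee_fin sqr_ge0.
move=> x _ /=; rewrite -EFinD sqr_sqrtr ?addr_ge0 ?sqr_ge0//.
by rewrite !real_normK ?num_real.
Qed.

Definition l2re (f : l2C R X) : l2R R X := L2 (re_subproof f).
Definition l2im (f : l2C R X) : l2R R X := L2 (im_subproof f).
Definition l2complex (f g : l2R R X) : l2C R X := L2 (complex_subproof f g).

Definition re_op (a : l2C R X -> l2C R X) : l2R R X -> l2R R X :=
  fun f => l2re (a (l2complex f 0)).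
Definition im_op (a : l2C R X -> l2C R X) : l2R R X -> l2R R X :=
  fun f => l2im (a (l2complex f 0)).
Definition complexify (S : l2R R X -> l2R R X) : l2C R X -> l2C R X :=
  fun f => l2complex (S (l2re f)) (S (l2im f)).

Lemma re_im_opE (a : l2C R X -> l2C R X) : linear a ->
  a = complexify (re_op a) + Complex 0 1 *: complexify (im_op a).
Proof.
move=> al; apply/funext => f.
have {1}-> : f = Complex 0 1 *: l2complex (l2im f) 0 + l2complex (l2re f) 0.
  apply/val_inj/funext => y.
  change (f y = Complex 0 1 * Complex (complex.Im (f y)) 0 +
                Complex (complex.Re (f y)) 0).
  by case: (f y) => p q; apply/eqP; rewrite eq_complex /=;
  apply/andP; split; apply/eqP; ring.
rewrite al addrC; apply/val_inj/funext => y.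
set u := a (l2complex (l2re f) 0); set w := a (l2complex (l2im f) 0).
change (u y + Complex 0 1 * w y =
  Complex (complex.Re (u y)) (complex.Re (w y)) +
  Complex 0 1 * Complex (complex.Im (u y)) (complex.Im (w y))).
by case: (u y) => p q; case: (w y) => r s; apply/eqP; rewrite eq_complex /=;
  apply/andP; split; apply/eqP; ring.
Qed.

End ComplexVectors.

Section RegularReal.
Context {R : realType} {X : choiceType}.
Implicit Types S T U : l2R R X -> l2R R X.

Definition le_op S T := positive_operator (T - S).

Definition regular_real : set (l2R R X -> l2R R X) :=
  [set T | exists P Q : l2R R X -> l2R R X,
    [/\ linear P, linear Q, positive_operator P, positive_operator Q
      & T = P - Q]].

Definition is_regular_sup (A : set (l2R R X -> l2R R X)) S :=
  [/\ regular_real S, forall T, A T -> le_op T S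
    & forall U, regular_real U -> (forall T, A T -> le_op T U) -> le_op S U].

(* Least upper bound in the lattice of regular operators, and the junk value
   [0] when there is none. *)
Definition regular_sup (A : set (l2R R X -> l2R R X)) : l2R R X -> l2R R X :=
  xget 0 (is_regular_sup A).

Definition real_modulus T : l2R R X -> l2R R X := regular_sup [set T; - T].

End RegularReal.

Section Regular.
Context {R : realType} {X : choiceType}.
Implicit Type a : l2C R X -> l2C R X.

Definition regular : set (l2C R X -> l2C R X) :=
  [set a | [/\ bounded_operator a, regular_real (re_op a)
             & regular_real (im_op a)]].

Definition modulus a : l2R R X -> l2R R X :=
  regular_sup [set real_modulus (cos t *: re_op a + sin t *: im_op a)
              | t in `[0, 2 * pi]].

(* The norm is taken over the real l2 space. *)
Definition regular_norm a : R := opnorm (modulus a).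

End Regular.

Definition regular_roe_algebra (R : realType) (X : metricType R) :
    set (l2C R X -> l2C R X) :=
  norm_closure regular_norm regular (band_operator X).

Arguments regular_roe_algebra {R} X a.

Section Maps.
Context {R : realType} {V W : lmodType R[i]}.
Implicit Types (A : set V) (B : set W).

Definition mutually_inverse A B (Phi : V -> W) (Psi : W -> V) : Prop :=
  [/\ set_fun A B Phi, set_fun B A Psi,
      forall a, A a -> Psi (Phi a) = a & forall b, B b -> Phi (Psi b) = b].

Definition linear_on A (Phi : V -> W) : Prop :=
  forall (c : R[i]) a b, A a -> A b -> Phi (c *: a + b) = c *: Phi a + Phi b.

Definition bounded_on A (N : V -> R) (N' : W -> R) (Phi : V -> W) : Prop :=
  exists M : R, forall a, A a -> N' (Phi a) <= M * N a.

Definition continuous_on A (N : V -> R) (N' : W -> R) (Phi : V -> W) : Prop :=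
  forall a, A a -> forall e : R, 0 < e -> exists2 d : R, 0 < d &
    forall b, A b -> N (b - a) < d -> N' (Phi b - Phi a) < e.

End Maps.

Section Isomorphisms.
Context {R : realType}.

Definition ordered_banach_isomorphic (X Y : choiceType)
    (A : set (l2C R X -> l2C R X)) (B : set (l2C R Y -> l2C R Y)) : Prop :=
  exists Phi Psi,
    [/\ mutually_inverse A B Phi Psi, linear_on A Phi,
        bounded_on A opnorm opnorm Phi /\
        bounded_on B opnorm opnorm Psi,
        forall a, A a -> positive_operator a -> positive_operator (Phi a)
      & forall b, B b -> positive_operator b -> positive_operator (Psi b)].

Definition banach_lattice_isomorphic (X Y : choiceType)
    (A : set (l2C R X -> l2C R X)) (B : set (l2C R Y -> l2C R Y)) : Prop :=
  exists Phi Psi,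
    [/\ mutually_inverse A B Phi Psi, linear_on A Phi,
        continuous_on A regular_norm regular_norm Phi,
        continuous_on B regular_norm regular_norm Psi
      & forall a, A a ->
          complexify (modulus (Phi a)) = Phi (complexify (modulus a))].

End Isomorphisms.

(* Main.v *)
(* A ray carries the metric of [nat], and inside the star two points on
   different rays, at positions [m] and [n], are at distance comparable to
   [m + n]. So the matrix of a band operator on the star consists of 8 band
   matrices over [nat * nat] on the diagonal and 56 finitely supported ones
   off the diagonal; for the line, which has 2 rays, there are 2 of each
   kind. Splitting [nat] by parity in rows and in columns turns a band
   matrix into 4 band matrices, hence 2 into 8; splitting only the columns
   of the 2 off-diagonal blocks into 28 classes each gives 56 blocks. The
   resulting bijection between the matrix entries moves finitely many
   rectangular blocks, so it is bounded and positive in both directions on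
   all operators, and preserves bands. As a linear order isomorphism it
   commutes with suprema, hence with the modulus.

   A coarse equivalence from the line to the star sends each of the two ends
   of the line, up to a bounded part, into a single ray, so a third ray is
   not covered. *)
Require Import Defs.
From HB Require Import structures.
From mathcomp Require Import all_boot all_order all_algebra.
From mathcomp Require Import all_classical all_reals all_analysis.
From mathcomp Require Import complex.
From mathcomp Require Import zify ring lra.

Set Implicit Arguments.
Unset Strict Implicit.
Unset Printing Implicit Defensive.

Import Order.TTheory GRing.Theory Num.Theory.

Local Open Scope classical_set_scope.
Local Open Scope ring_scope.

Lemma linearB_op (K : pzRingType) (V W : lmodType K) (P Q : V -> W) :
  linear P -> linear Q -> linear (P - Q).
Proof.
move=> Pl Ql c f g; rewrite [LHS](_ : _ = P (c *: f + g) - Q (c *: f + g))//.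
by rewrite Pl Ql opprD addrACA -scalerBr.
Qed.

(** Dividing by [C + 1] rather than by [C] keeps the denominator positive when [C] is 0. *)
Lemma mulr_small (R : realFieldType) (C m e : R) :
  0 <= C -> 0 < e -> m < e / (C + 1) -> C * m < e.
Proof.
move=> C0 e0; have C1 : 0 < C + 1 by rewrite ltr_wpDl.
rewrite ltr_pdivlMr// => me; have [m0|m0] := leP 0 m; last first.
  by apply: le_lt_trans e0; rewrite mulr_ge0_le0// ltW.
by apply: le_lt_trans me; rewrite mulrC ler_wpM2l// lerDl.
Qed.

(** * Pointwise calculus and norm estimates in l2 *)

Section L2Norm.
Context {R : realType} {K : numFieldType} (v : absval R K) (X : choiceType).
Implicit Types (f g : l2 v X).

Definition l2sum f : \bar R := (\esum_(x in [set: X]) (v (f x) ^+ 2)%:E)%E.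

Lemma absval0 : v 0 = 0.
Proof. by apply/eqP; rewrite abs_eq0. Qed.

Lemma l2P_lt f : (l2sum f < +oo)%E.
Proof. by have := l2P f; rewrite unfold_in. Qed.

Lemma l2sum_ge0 f : (0 <= l2sum f)%E.
Proof. by apply: esum_ge0 => x _; rewrite lee_fin sqr_ge0. Qed.

Lemma l2sumE f : l2sum f = (l2norm f ^+ 2)%:E.
Proof.
rewrite /l2norm sqr_sqrtr ?fine_ge0 ?l2sum_ge0// fineK// ge0_fin_numE ?l2P_lt//.
exact: l2sum_ge0.
Qed.

Lemma l2norm_ge0 f : 0 <= l2norm f.
Proof. exact: sqrtr_ge0. Qed.

Lemma l2D_app f g x : (f + g) x = f x + g x.
Proof. by []. Qed.

Lemma l2Z_app (c : K) f x : (c *: f) x = c * f x.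
Proof. by []. Qed.

Lemma l2_ext f g : (forall x, f x = g x) -> f = g.
Proof. by move=> fg; apply/val_inj/funext. Qed.

Lemma l2_sum_app (I : Type) (r : seq I) (P : pred I) (F : I -> l2 v X) x :
  (\sum_(i <- r | P i) F i) x = \sum_(i <- r | P i) F i x.
Proof. by elim/big_rec2: _ => // i y z _ <-. Qed.

Lemma l2norm0 : l2norm (0 : l2 v X) = 0.
Proof.
rewrite /l2norm esum1 ?sqrtr0// => x _.
by rewrite [v _]absval0 expr0n.
Qed.

(* The sharp constant is 1, but any constant serves. *)
Lemma l2normD f g : l2norm (f + g) <= 2 * (l2norm f + l2norm g).
Proof.
have h : (l2sum (f + g)%R <=
    \esum_(x in [set: X]) ((2 * v (f x) ^+ 2)%:E + (2 * v (g x) ^+ 2)%:E))%E.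
  apply: le_esum => x _; rewrite -EFinD lee_fin l2D_app.
  have : v (f x + g x) ^+ 2 <= (v (f x) + v (g x)) ^+ 2.
    by rewrite ler_sqr ?nnegrE ?absD ?addr_ge0 ?abs_ge0.
  by have := sqr_ge0 (v (f x) - v (g x)); nra.
have D (u : l2 v X) :
    (\esum_(x in [set: X]) (2 * v (u x) ^+ 2)%:E = l2sum u + l2sum u)%E.
  rewrite -esumD; try by move=> *; rewrite lee_fin sqr_ge0.
  by apply: eq_esum => x _; rewrite -EFinD mulr_natl mulr2n.
move: h; rewrite esumD; try by move=> *; rewrite lee_fin mulr_ge0 ?sqr_ge0.
rewrite !D !l2sumE -!EFinD lee_fin => h.
rewrite -ler_sqr ?nnegrE ?mulr_ge0 ?addr_ge0 ?l2norm_ge0//.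
by have := l2norm_ge0 f; have := l2norm_ge0 g; nra.
Qed.

(** [C] depends on the index sequence alone, which later makes the bounds for [retile] uniform in
    the operator. *)
Lemma l2norm_sum (I : Type) (r : seq I) : exists2 C : R, 0 <= C &
  forall (F : I -> l2 v X) (m : R),
  0 <= m -> (forall i, l2norm (F i) <= m) ->
  l2norm (\sum_(i <- r) F i) <= C * m.
Proof.
elim: r => [|i r [C C0 IH]].
  by exists 0 => // F m m0 _; rewrite big_nil l2norm0 mul0r.
exists (2 * (1 + C)); first by rewrite mulr_ge0// addr_ge0.
move=> F m m0 Fm; rewrite big_cons (le_trans (l2normD _ _))//.
by rewrite -mulrA ler_wpM2l// mulrDl mul1r lerD// IH.
Qed.

End L2Norm.

(** * Partial isometries matching two injective sequences of basis vectors *)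

Section Transfer.
Context {R : realType} {K : numFieldType} (v : absval R K) (X Y : choiceType).
Variables (k : nat -> Y) (h : nat -> X).
Hypotheses (k_inj : injective k) (h_inj : injective h).

Definition transfer_fun (f : X -> K^o) (y : Y) : K^o :=
  if pselect (exists i, k i = y) is left e then f (h (projT1 (cid e))) else 0.

Lemma transfer_funE f i : transfer_fun f (k i) = f (h i).
Proof.
rewrite /transfer_fun; case: pselect => [e|[]]; last by exists i.
by case: cid => j /= /k_inj ->.
Qed.

Lemma transfer_fun_out f y : (forall i, k i <> y) -> transfer_fun f y = 0.
Proof.
by move=> ky; rewrite /transfer_fun; case: pselect => // e; have [i /ky] := e.
Qed.

Lemma transfer_fun_sum f :
  (\esum_(y in [set: Y]) (v (transfer_fun f y) ^+ 2)%:E <=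
   \esum_(x in [set: X]) (v (f x) ^+ 2)%:E)%E.
Proof.
have sq0 z : (0 <= (v z ^+ 2)%:E)%E by rewrite lee_fin sqr_ge0.
rewrite (esumID (range k))// [X in (_ + X)%E]esum1 ?adde0; last first.
  move=> y [_ /= ky]; rewrite transfer_fun_out ?absval0 ?expr0n// => i ki.
  by apply: ky; exists i.
rewrite setTI esum_image; last by move=> i j _ _; exact: k_inj.
under eq_esum do rewrite transfer_funE.
rewrite [leRHS](esumID (range h))// setTI esum_image; last first.
  by move=> i j _ _; exact: h_inj.
by rewrite leeDl// esum_ge0.
Qed.

Lemma transfer_subproof (f : l2 v X) : transfer_fun f \in square_summable v.
Proof.
by rewrite unfold_in (le_lt_trans (transfer_fun_sum f))// l2P_lt.
Qed.

(* The partial isometry sending the basis vector at [h i] to the one at [k i],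
   and vanishing on the orthogonal complement of the range of [h]. *)
Definition transfer (f : l2 v X) : l2 v Y := L2 (transfer_subproof f).

Lemma transferE f i : transfer f (k i) = f (h i).
Proof. exact: transfer_funE. Qed.

Lemma transfer_out f y : (forall i, k i <> y) -> transfer f y = 0.
Proof. exact: transfer_fun_out. Qed.

Lemma transfer_norm f : l2norm (transfer f) <= l2norm f.
Proof.
rewrite -ler_sqr ?nnegrE ?l2norm_ge0// -lee_fin -!l2sumE.
exact: transfer_fun_sum.
Qed.

Lemma transfer_cases f y :
  (exists2 i, k i = y & transfer f y = f (h i)) \/
  ((forall i, k i <> y) /\ transfer f y = 0).
Proof.
have [[i <-]|ky] := pselect (exists i, k i = y).
  by left; exists i => //; rewrite transferE.
have {}ky i : k i <> y by move=> e; apply: ky; exists i.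
by right; rewrite transfer_out.
Qed.

Lemma transfer_unique (f : l2 v X) (g : l2 v Y) :
  (forall i, g (k i) = f (h i)) ->
  (forall y, (forall i, k i <> y) -> g y = 0) -> g = transfer f.
Proof.
move=> gk g0; apply: l2_ext => y.
have [[i <- ->]|[ky ->]] := transfer_cases f y; first exact: gk.
exact: g0.
Qed.

Lemma transfer_is_linear : linear transfer.
Proof.
move=> c f g; apply/esym/transfer_unique => [i|y ky].
  by rewrite l2D_app l2Z_app !transferE.
by rewrite l2D_app l2Z_app !transfer_out// mulr0 addr0.
Qed.

HB.instance Definition _ :=
  GRing.isLinear.Build K (l2 v X) (l2 v Y) _ transfer transfer_is_linear.

End Transfer.

(** * Tilings of a square and the induced rearrangement of operators *)

(* A partition of the square of [X] into rectangles indexed by [B], each of them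
   parametrised by [nat * nat]. *)
Record tiling (B : finType) (X : Type) := Tiling {
  tile_row : B -> nat -> X ;
  tile_col : B -> nat -> X ;
  tile_surj : forall x y, exists b i j, tile_row b i = x /\ tile_col b j = y ;
  tile_inj : forall b b' i i' j j',
    tile_row b i = tile_row b' i' -> tile_col b j = tile_col b' j' ->
    [/\ b = b', i = i' & j = j'] }.

Section TilingTheory.
Context (B : finType) (X : Type) (t : tiling B X).

Lemma row_inj b : injective (tile_row t b).
Proof. by move=> i i' e; have [] := tile_inj (j := 0) e erefl. Qed.

Lemma col_inj b : injective (tile_col t b).
Proof. by move=> j j' e; have [] := tile_inj (i := 0) erefl e. Qed.

End TilingTheory.

Section Retile.
Context {R : realType} {K : numFieldType} (v : absval R K).
Context (B : finType) (X Y : choiceType) (t : tiling B X) (u : tiling B Y).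

(** The block of [a] on each tile of [t] is moved to the tile of [u] with the same index. Rows index
    the input coordinate and columns the output coordinate. *)
Definition retile (a : l2 v X -> l2 v X) (f : l2 v Y) : l2 v Y :=
  \sum_b transfer (@col_inj _ _ u b) (@col_inj _ _ t b)
    (a (transfer (@row_inj _ _ t b) (@row_inj _ _ u b) f)).

Lemma retile_linear a : linear a -> linear (retile a).
Proof.
move=> al c f g; rewrite /retile scaler_sumr -big_split /=.
by apply: eq_bigr => b _; rewrite linearP al linearP.
Qed.

Lemma retileP c a b : retile (c *: a + b) = c *: retile a + retile b.
Proof.
apply/funext => f; rewrite /retile.
rewrite [RHS](_ : _ = c *: retile a f + retile b f)// /retile.
by rewrite scaler_sumr -big_split /=; apply: eq_bigr => d _; rewrite -linearP.
Qed.

Lemma retile0 : retile 0 = 0.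
Proof.
apply/funext => f; rewrite /retile big1// => b _.
by rewrite [X in transfer _ _ X](_ : _ = 0) ?linear0.
Qed.

Lemma retileD a b : retile (a + b) = retile a + retile b.
Proof. by have := retileP 1 a b; rewrite !scale1r. Qed.

Lemma retileZ c a : retile (c *: a) = c *: retile a.
Proof. by have := retileP c a 0; rewrite retile0 !addr0. Qed.

Lemma retileB a b : retile (a - b) = retile a - retile b.
Proof. by have := retileP (-1) b a; rewrite !scaleN1r ![- _ + _]addrC. Qed.

Lemma retileN a : retile (- a) = - retile a.
Proof. by have := retileB 0 a; rewrite retile0 !sub0r. Qed.

Lemma retile_positive a : positive_operator a -> positive_operator (retile a).
Proof.
move=> a0 f f0 y; rewrite l2_sum_app sumr_ge0// => b _.
have [[j _ ->]|[_ ->//]] := transfer_cases (@col_inj _ _ u b)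
  (@col_inj _ _ t b) (a (transfer (@row_inj _ _ t b) (@row_inj _ _ u b) f)) y.
apply: a0 => x.
by have [[i _ ->]|[_ ->]] := transfer_cases (@row_inj _ _ t b)
  (@row_inj _ _ u b) f x.
Qed.

(** Transfers are contractions, so each of the finitely many terms is bounded by [m]. The unit ball
    matches the supremum in [opnorm]. *)
Lemma retile_bound : exists2 C : R, 0 <= C & forall a m, 0 <= m ->
  (forall f, l2norm f <= 1 -> l2norm (a f) <= m) ->
  forall f, l2norm f <= 1 -> l2norm (retile a f) <= C * m.
Proof.
have [C C0 HC] := l2norm_sum v Y (index_enum B).
exists C => // a m m0 am f f1; apply: HC => // b.
apply: le_trans (transfer_norm _ _ _) _; apply: am.
exact: le_trans (transfer_norm _ _ _) f1.
Qed.

Lemma retile_bounded a : bounded_operator a -> bounded_operator (retile a).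
Proof.
move=> [al [M aM]]; split; first exact: retile_linear.
have [C C0 HC] := l2norm_sum v Y (index_enum B).
exists (C * `|M|) => f; rewrite -mulrA; apply: HC => [|b].
  by rewrite mulr_ge0 ?l2norm_ge0.
apply: le_trans (transfer_norm _ _ _) _; apply: le_trans (aM _) _.
apply: le_trans (ler_wpM2r (l2norm_ge0 _) (ler_norm M)) _.
by rewrite ler_wpM2l// transfer_norm.
Qed.

End Retile.

(** * Inverse of a retiling, and its action on matrix entries *)

Section RetileK.
Context {R : realType} {K : numFieldType} (v : absval R K).
Context (B : finType) (X Y : choiceType) (t : tiling B X) (u : tiling B Y).
Variable a : l2 v X -> l2 v X.
Hypothesis al : linear a.

Let a0 : a 0 = 0.
Proof. by have := al (-1) 0 0; rewrite scaler0 addr0 scaleN1r addNr. Qed.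

Let a_sum (I : finType) (P : pred I) (F : I -> l2 v X) :
  a (\sum_(i | P i) F i) = \sum_(i | P i) a (F i).
Proof.
apply: (big_morph a) => // f g.
by have := al 1 f g; rewrite !scale1r.
Qed.

(** Distinct tiles are disjoint rectangles, so if their column ranges meet then their row ranges do
    not. *)
Lemma transfer_row_neq b b' f :
  (exists j j', tile_col u b j = tile_col u b' j') ->
  b != b' ->
  transfer (@row_inj _ _ t b') (@row_inj _ _ u b')
    (transfer (@row_inj _ _ u b) (@row_inj _ _ t b) f) = 0 :> l2 v X.
Proof.
move=> [j [j' jj']] bb'; apply: l2_ext => x.
have [[i _ ->]|[_ ->//]] := transfer_cases (@row_inj _ _ t b')
  (@row_inj _ _ u b') (transfer (@row_inj _ _ u b) (@row_inj _ _ t b) f) x.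
rewrite transfer_out// => i' ii'.
by have [bb _ _] := tile_inj ii' jj'; rewrite bb eqxx in bb'.
Qed.

Lemma retile_col b j g : retile t u a g (tile_col u b j) =
  \sum_b' transfer (@col_inj _ _ u b') (@col_inj _ _ t b')
    (a (transfer (@row_inj _ _ t b') (@row_inj _ _ u b') g)) (tile_col u b j).
Proof. exact: l2_sum_app. Qed.

(** For a fixed output coordinate [x], only tiles of [t] whose columns contain [x] contribute. Their
    rows partition [X], so the restrictions [res b] of [f] to these rows add up to [f]. *)
Lemma retileK : retile u t (retile t u a) = a.
Proof.
apply/funext => f; apply: l2_ext => x.
pose res b : l2 v X := transfer (@row_inj _ _ t b) (@row_inj _ _ t b) f.
pose P b := `[< exists j, tile_col t b j = x >].
transitivity (\sum_(b | P b) a (res b) x).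
  rewrite [LHS]l2_sum_app [RHS]big_mkcond; apply: eq_bigr => b _.
  have [/asboolP[j <-]|/asboolPn nP] := boolP (P b); last first.
    by rewrite transfer_out// => j jx; apply: nP; exists j.
  rewrite transferE retile_col (bigD1 b)// big1 => [|b' b'b].
    rewrite [LHS]addr0 transferE; congr (l2_fun (a _) _); apply: l2_ext => y.
    have [[i <-]|ny] := pselect (exists i, tile_row t b i = y).
      by rewrite !transferE.
    by rewrite !transfer_out// => i iy; apply: ny; exists i.
  (* A tile [b'] of [u] that also meets this column has rows disjoint from those of [b], hence
     contributes [a 0]. *)
  have [[j' j'j _]|[_ ->//]] := transfer_cases (@col_inj _ _ u b')
    (@col_inj _ _ t b') (a (transfer (@row_inj _ _ t b') (@row_inj _ _ u b')
    (transfer (@row_inj _ _ u b) (@row_inj _ _ t b) f))) (tile_col u b j).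
  rewrite transfer_row_neq; last by rewrite eq_sym.
    by rewrite a0 -j'j transferE.
  by exists j, j'.
rewrite -l2_sum_app -a_sum; congr (l2_fun (a _) _); apply: l2_ext => y.
rewrite l2_sum_app; have [b [i [j [iy jx]]]] := tile_surj t y x.
rewrite (bigD1 b); last by apply/asboolP; exists j.
rewrite big1 => [|b' /andP[/asboolP[j' j'x] b'b]].
  by rewrite [LHS]addr0 /res -iy transferE.
rewrite /res transfer_out// => i' i'y.
have [bb _ _] : [/\ b' = b, i' = i & j' = j].
  by apply: (tile_inj (t := t)); rewrite ?i'y ?j'x.
by rewrite bb eqxx in b'b.
Qed.

(** Retiling only relocates matrix entries; this carries the band condition from one space to the
    other. *)
Lemma retile_delta b i j :
  retile t u a (l2delta v (tile_row u b i)) (tile_col u b j) =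
  a (l2delta v (tile_row t b i)) (tile_col t b j).
Proof.
(* Among the tiles of [u] that meet the chosen column, only [b] has the chosen row. *)
have D b' : (exists j', tile_col u b' j' = tile_col u b j) ->
    transfer (@row_inj _ _ t b') (@row_inj _ _ u b')
      (l2delta v (tile_row u b i)) =
    if b' == b then l2delta v (tile_row t b i) else 0.
  move=> [j' j'j]; apply: l2_ext => x.
  have [[i' i'x ->]|[nx ->]] := transfer_cases (@row_inj _ _ t b')
    (@row_inj _ _ u b') (l2delta v (tile_row u b i)) x; rewrite /=.
    case: (eqVneq b' b) => [bb|b'b] /=.
      subst b'; rewrite -i'x; congr (_%:R); congr nat_of_bool.
      apply/eqP/eqP => [/row_inj->//|/row_inj->//].
    case: eqP => // e.
    by have [bb _ _] := tile_inj e j'j; rewrite bb eqxx in b'b.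
  case: (eqVneq b' b) => [bb|b'b] //=.
  by subst b'; case: eqP => // e; case: (nx i).
rewrite retile_col (bigD1 b)// big1 => [|b' b'b].
  by rewrite [LHS]addr0 transferE D ?eqxx//; exists j.
have [[j' j'j ->]|[_ ->//]] := transfer_cases (@col_inj _ _ u b')
    (@col_inj _ _ t b') (a (transfer (@row_inj _ _ t b') (@row_inj _ _ u b')
    (l2delta v (tile_row u b i)))) (tile_col u b j).
by rewrite D ?(negPf b'b) ?a0//; exists j'.
Qed.

End RetileK.

(** * Retiling and the operator norm *)

Section OperatorNorm.
Context {R : realType} {K : numFieldType} (v : absval R K).
Context (B : finType) (X Y : choiceType) (t : tiling B X) (u : tiling B Y).

(* [opnorm] of an unbounded operator is the junk value [sup S = 0] for [S]
   unbounded; [retile] preserves and reflects boundedness. *)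
Lemma opnorm_retile : exists2 C : R, 0 <= C & forall a : l2 v X -> l2 v X,
  linear a -> opnorm (retile t u a) <= C * opnorm a.
Proof.
have [C C0 HC] := retile_bound v t u; have [D D0 HD] := retile_bound v u t.
exists C => // a al; rewrite /opnorm.
set S := [set l2norm (a f) | f in _]; set S' := [set l2norm (_ f) | f in _].
have S'0 : S' !=set0.
  by exists (l2norm (retile t u a 0)), 0 => //=; rewrite l2norm0.
have [bS|nbS] := pselect (has_ubound S).
  have aS f : l2norm f <= 1 -> l2norm (a f) <= sup S.
    by move=> f1; apply: ub_le_sup => //; exists f.
  apply: ge_sup => // _ [f /= f1 <-]; apply: HC => //.
  by apply: le_trans (aS 0 _); rewrite ?l2norm_ge0 ?l2norm0.
rewrite (sup_out (E := S)) ?mulr0; last by case.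
rewrite sup_out// => -[_ [m mS']]; apply: nbS.
have aS' f : l2norm f <= 1 -> l2norm (retile t u a f) <= m.
  by move=> f1; apply: mS'; exists f.
exists (D * m) => _ [f /= f1 <-].
rewrite -(retileK t u al); apply: HD => //.
by apply: le_trans (aS' 0 _); rewrite ?l2norm_ge0 ?l2norm0.
Qed.

End OperatorNorm.

(** * Retiling as an order isomorphism that preserves suprema *)

Section RegularSup.
Context {R : realType}.

Section LeOp.
Context {X : choiceType}.
Implicit Types (f : l2R R X) (S T : l2R R X -> l2R R X).

Let pos_subproof f :
  (fun x => Num.max (f x : R) 0) \in square_summable (real_abs R).
Proof.
have := l2P f; rewrite !unfold_in; apply: le_lt_trans.
apply: le_esum => x _; rewrite lee_fin /= !real_normK ?num_real//.
by rewrite /Num.max; case: ifPn => // _; rewrite expr0n sqr_ge0.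
Qed.

Definition l2pos f : l2R R X := L2 (pos_subproof f).

Lemma linearB_app S f g : linear S -> S (f - g) = S f - S g.
Proof. by move=> Sl; rewrite addrC -scaleN1r Sl scaleN1r addrC. Qed.

(** The two order relations give equality on nonnegative vectors, and every vector is the difference
    of two of these, [l2pos f] and [l2pos f - f]. *)
Lemma le_op_anti S T : linear S -> linear T -> le_op S T -> le_op T S -> S = T.
Proof.
move=> Sl Tl ST TS.
have E f : (forall x, 0 <= f x) -> S f = T f.
  move=> f0; apply: l2_ext => x; apply: le_anti; apply/andP; split.
    have := ST f f0 x.
    by rewrite [X in _ <= X](_ : _ = T f x - S f x)// subr_ge0.
  have := TS f f0 x.
  by rewrite [X in _ <= X](_ : _ = S f x - T f x)// subr_ge0.
apply/funext => f; have pg x : 0 <= (l2pos f - f) x.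
  rewrite [X in _ <= X](_ : _ = Num.max (f x : R) 0 - f x)// subr_ge0.
  by rewrite le_max lexx.
have pp x : 0 <= l2pos f x.
  by rewrite [X in _ <= X](_ : _ = Num.max (f x : R) 0)// le_max lexx orbT.
have {1 2}-> : f = l2pos f - (l2pos f - f) by rewrite opprB addrC subrK.
by rewrite (linearB_app _ _ Sl) (linearB_app _ _ Tl) (E _ pp) (E _ pg).
Qed.

Lemma linear_regular S : regular_real S -> linear S.
Proof. by move=> [P [Q [Pl Ql _ _ ->]]]; exact: linearB_op. Qed.

(** Holds whether or not the supremum exists, since the junk value 0 is linear. *)
Lemma linear_regular_sup (A : set (l2R R X -> l2R R X)) :
  linear (regular_sup A).
Proof.
rewrite /regular_sup; case: xgetP => [S _ [/linear_regular]//|_ c f g].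
by rewrite [RHS](_ : _ = c *: 0 + 0)// scaler0 addr0.
Qed.

Lemma regular_sup_unique (A : set (l2R R X -> l2R R X)) S :
  is_regular_sup A S -> regular_sup A = S.
Proof.
move=> AS; apply: xget_unique => // T AT.
case: AS AT => [Sr AS Sm] [Tr AT Tm].
by apply: le_op_anti; [exact: linear_regular..|exact: Tm|exact: Sm].
Qed.

End LeOp.

Context (B : finType).

Lemma le_op_retile (X Y : choiceType) (t : tiling B X) (u : tiling B Y)
    (S T : l2R R X -> l2R R X) :
  le_op S T -> le_op (retile t u S) (retile t u T).
Proof. by move=> ST; rewrite /le_op -retileB; exact: retile_positive. Qed.

Lemma regular_real_retile (X Y : choiceType) (t : tiling B X) (u : tiling B Y)
    (S : l2R R X -> l2R R X) :
  regular_real S -> regular_real (retile t u S).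
Proof.
move=> [P [Q [Pl Ql P0 Q0 ->]]]; exists (retile t u P), (retile t u Q).
split; [exact: retile_linear..|exact: retile_positive|exact: retile_positive|].
exact: retileB.
Qed.

(** An upper bound [U] of the image is pulled back by [retile u t], compared with [S] there, and
    pushed forward again. *)
Lemma is_regular_sup_retile (X Y : choiceType) (t : tiling B X) (u : tiling B Y)
    (A : set (l2R R X -> l2R R X)) S :
  (forall T, A T -> linear T) -> is_regular_sup A S ->
  is_regular_sup (retile t u @` A) (retile t u S).
Proof.
move=> Al [Sr AS Sm]; split; first exact: regular_real_retile.
  by move=> _ [T AT <-]; apply: le_op_retile; exact: AS.
move=> U Ur AU; rewrite -(retileK u t (linear_regular Ur)).
apply: le_op_retile; apply: Sm; first exact: regular_real_retile.
move=> T AT; rewrite -(retileK t u (Al _ AT)); apply: le_op_retile.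
by apply: AU; exists T.
Qed.

Context {X Y : choiceType} (t : tiling B X) (u : tiling B Y).

Lemma regular_sup_retile (A : set (l2R R X -> l2R R X)) :
  (forall T, A T -> linear T) ->
  regular_sup (retile t u @` A) = retile t u (regular_sup A).
Proof.
move=> Al; rewrite {2}/regular_sup; case: xgetP => [S _ AS|nS].
  by apply: regular_sup_unique; exact: is_regular_sup_retile.
(* If [A] has no supremum, both sides are 0: a supremum of the image would be carried back by
   [retile u t] to one of [A]. *)
rewrite retile0 /regular_sup; apply: xgetPN => S /(is_regular_sup_retile u t).
rewrite image_comp (_ : _ @` A = A); last first.
  apply/seteqP; split=> [_ [T AT <-]/=|T AT].
    by rewrite retileK//; exact: Al.
  by exists T => //=; rewrite retileK//; exact: Al.
move=> AS; apply: (nS _ (AS _)) => _ [T AT <-].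
by apply: retile_linear; exact: Al.
Qed.

Lemma real_modulus_retile (T : l2R R X -> l2R R X) : linear T ->
  real_modulus (retile t u T) = retile t u (real_modulus T).
Proof.
move=> Tl; rewrite /real_modulus -regular_sup_retile.
  by rewrite image_setU !image_set1 retileN.
move=> _ [->//|->] c f g.
by rewrite [LHS](_ : _ = - T (c *: f + g))// Tl opprD -scalerN.
Qed.

End RegularSup.

(** * Real and imaginary parts, modulus and regular norm *)

Section ComplexTransfer.
Context {R : realType} {X Y : choiceType} (k : nat -> Y) (h : nat -> X).
Hypotheses (k_inj : injective k) (h_inj : injective h).

Lemma transfer_re (f : l2C R X) :
  l2re (transfer k_inj h_inj f) = transfer k_inj h_inj (l2re f).
Proof.
apply: transfer_unique => [i|y ky].
  rewrite [LHS](_ : _ = complex.Re (transfer k_inj h_inj f (k i)))//.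
  by rewrite transferE.
rewrite [LHS](_ : _ = complex.Re (transfer k_inj h_inj f y))//.
by rewrite transfer_out.
Qed.

Lemma transfer_im (f : l2C R X) :
  l2im (transfer k_inj h_inj f) = transfer k_inj h_inj (l2im f).
Proof.
apply: transfer_unique => [i|y ky].
  rewrite [LHS](_ : _ = complex.Im (transfer k_inj h_inj f (k i)))//.
  by rewrite transferE.
rewrite [LHS](_ : _ = complex.Im (transfer k_inj h_inj f y))//.
by rewrite transfer_out.
Qed.

Lemma transfer_complex (f g : l2R R X) :
  transfer k_inj h_inj (l2complex f g) =
  l2complex (transfer k_inj h_inj f) (transfer k_inj h_inj g).
Proof.
pose F y := Complex (transfer k_inj h_inj f y) (transfer k_inj h_inj g y).
apply/esym/transfer_unique => [i|y ky].
  by rewrite [LHS](_ : _ = F (k i))// /F !transferE.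
by rewrite [LHS](_ : _ = F y)// /F !transfer_out.
Qed.

End ComplexTransfer.

Section ComplexSums.
Context {R : realType} {X : choiceType} (I : finType).

Lemma l2re_sum (F : I -> l2C R X) : l2re (\sum_i F i) = \sum_i l2re (F i).
Proof.
apply: (big_morph l2re) => [f g|]; apply: l2_ext => x //.
rewrite [LHS](_ : _ = complex.Re (f x + g x))//.
by rewrite l2D_app /=; case: (f x); case: (g x).
Qed.

Lemma l2im_sum (F : I -> l2C R X) : l2im (\sum_i F i) = \sum_i l2im (F i).
Proof.
apply: (big_morph l2im) => [f g|]; apply: l2_ext => x //.
rewrite [LHS](_ : _ = complex.Im (f x + g x))//.
by rewrite l2D_app /=; case: (f x); case: (g x).
Qed.

Lemma l2complex_sum (F G : I -> l2R R X) :
  l2complex (\sum_i F i) (\sum_i G i) = \sum_i l2complex (F i) (G i).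
Proof.
apply: (big_ind3 (fun f g h => l2complex f g = h)) => //; first exact: l2_ext.
by move=> f f' g g' h h' <- <-; exact: l2_ext.
Qed.

End ComplexSums.

Section Complex.
Context {R : realType} (B : finType) {X Y : choiceType}.
Context (t : tiling B X) (u : tiling B Y).
Implicit Type a : l2C R X -> l2C R X.

(** Transfers have matrix entries 0 and 1, so they act on real and imaginary parts separately. *)
Lemma re_op_retile a : re_op (retile t u a) = retile t u (re_op a).
Proof.
apply/funext => f; rewrite /re_op /retile l2re_sum.
by apply: eq_bigr => b _; rewrite transfer_re transfer_complex linear0.
Qed.

Lemma im_op_retile a : im_op (retile t u a) = retile t u (im_op a).
Proof.
apply/funext => f; rewrite /im_op /retile l2im_sum.
by apply: eq_bigr => b _; rewrite transfer_im transfer_complex linear0.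
Qed.

Lemma complexify_retile (S : l2R R X -> l2R R X) :
  complexify (retile t u S) = retile t u (complexify S).
Proof.
apply/funext => f; rewrite /complexify /retile l2complex_sum.
by apply: eq_bigr => b _; rewrite transfer_complex transfer_re transfer_im.
Qed.

Lemma l2complex_linear c (f g : l2R R X) :
  l2complex (c *: f + g) 0 = Complex c 0 *: l2complex f 0 + l2complex g 0.
Proof.
apply: l2_ext => x; rewrite [LHS](_ : _ = Complex (c * f x + g x) 0)//.
rewrite [RHS](_ : _ = Complex c 0 * Complex (f x) 0 + Complex (g x) 0)//.
by apply/eqP; rewrite eq_complex /=; apply/andP; split; apply/eqP; ring.
Qed.

Lemma re_op_linear a : linear a -> linear (re_op a).
Proof.
move=> al c f g; rewrite /re_op.
rewrite l2complex_linear al; set p := a _; set q := a _; apply: l2_ext => x.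
rewrite [LHS](_ : _ = complex.Re (Complex c 0 * p x + q x))//.
rewrite [RHS](_ : _ = c * complex.Re (p x) + complex.Re (q x))//.
by case: (p x) => ? ?; case: (q x) => ? ? /=; ring.
Qed.

Lemma im_op_linear a : linear a -> linear (im_op a).
Proof.
move=> al c f g; rewrite /im_op.
rewrite l2complex_linear al; set p := a _; set q := a _; apply: l2_ext => x.
rewrite [LHS](_ : _ = complex.Im (Complex c 0 * p x + q x))//.
rewrite [RHS](_ : _ = c * complex.Im (p x) + complex.Im (q x))//.
by case: (p x) => ? ?; case: (q x) => ? ? /=; ring.
Qed.

(** Retiling passes through both layers of suprema: the one over the angle and the real modulus
    inside it. *)
Lemma modulus_retile a : linear a ->
  modulus (retile t u a) = retile t u (modulus a).
Proof.
move=> al; rewrite /modulus -regular_sup_retile; last first.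
  by move=> _ [s _ <-]; exact: linear_regular_sup.
rewrite re_op_retile im_op_retile image_comp; congr regular_sup.
apply: eq_imagel => s _ /=.
rewrite -real_modulus_retile ?retileD ?retileZ//.
(* What remains is the linearity of the combination inside [real_modulus]. *)
move=> c f g; set p := re_op a; set q := im_op a.
rewrite [LHS](_ : _ = cos s *: p (c *: f + g) + sin s *: q (c *: f + g))//.
rewrite [RHS](_ : _ = c *: (cos s *: p f + sin s *: q f) +
  (cos s *: p g + sin s *: q g))//.
have pl : linear p := re_op_linear al; have ql : linear q := im_op_linear al.
rewrite pl ql !scalerDr !scalerA addrACA.
by rewrite ![_ * c]mulrC.
Qed.

Lemma regular_retile a : regular a -> regular (retile t u a).
Proof.
move=> [ab ar ai]; split; first exact: retile_bounded.
  by rewrite re_op_retile; exact: regular_real_retile.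
by rewrite im_op_retile; exact: regular_real_retile.
Qed.

Lemma regular_norm_retile : exists2 C : R, 0 <= C & forall a, linear a ->
  regular_norm (retile t u a) <= C * regular_norm a.
Proof.
have [C C0 HC] := opnorm_retile (real_abs R) t u; exists C => // a al.
rewrite /regular_norm modulus_retile//; apply: HC.
exact: linear_regular_sup.
Qed.

End Complex.

(** * Isomorphisms of the algebras from mutually controlled tilings *)

Definition controlled (R : realType) (B : finType) (X Y : metricType R)
    (t : tiling B X) (u : tiling B Y) :=
  forall r : R, exists s : R, forall b i j,
  mdist (tile_row t b i) (tile_col t b j) <= r ->
  mdist (tile_row u b i) (tile_col u b j) <= s.

Section Isomorphism.
Context {R : realType} {B : finType}.

Section OneSide.
Context {X Y : metricType R} (t : tiling B X) (u : tiling B Y).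
Hypothesis tu : controlled t u.

(** By [retile_delta] each entry comes from the same position of the same tile of [t]. If it is far
    from the diagonal in [Y], control forces it to be far in [X]. *)
Lemma band_retile (a : l2C R X -> l2C R X) :
  band_operator X a -> band_operator Y (retile t u a).
Proof.
move=> [ab [r r0 ar]]; split; first exact: retile_bounded.
(* The width of a band must be positive, while [s] may fail to be. *)
have [s Hs] := tu r; exists (Num.max s 1); first by rewrite lt_max ltr01 orbT.
move=> x y; rewrite gt_max => /andP[sxy _].
have [b [i [j [xE yE]]]] := tile_surj u x y; subst x y.
rewrite retile_delta; last by have [] := ab.
apply: ar; rewrite ltNge; apply/negP => /Hs.
by rewrite leNgt sxy.
Qed.

(** Stated for abstract norms and ambient sets, so that one argument serves both the uniform Roe
    algebra and its regular version. *)
Lemma norm_closure_retile (N : (l2C R X -> l2C R X) -> R)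
    (N' : (l2C R Y -> l2C R Y) -> R) E E' :
  (exists2 C : R, 0 <= C &
    forall a, linear a -> N' (retile t u a) <= C * N a) ->
  (forall a, E a -> linear a) -> (forall a, E a -> E' (retile t u a)) ->
  set_fun (norm_closure N E (band_operator X))
          (norm_closure N' E' (band_operator Y)) (retile t u).
Proof.
move=> [C C0 HC] El EE a [Ea aE]; split; first exact: EE.
move=> e e0; have C1 : 0 < C + 1 by rewrite ltr_wpDl.
have [b bb abe] := aE _ (divr_gt0 e0 C1).
exists (retile t u b); first exact: band_retile.
have [[bl _] _] := bb; have abl := linearB_op (El _ Ea) bl.
rewrite -retileB; apply: le_lt_trans (HC _ abl) _.
exact: mulr_small.
Qed.

Lemma roe_retile : set_fun (roe_algebra X) (roe_algebra Y) (retile t u).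
Proof.
apply: norm_closure_retile; first exact: opnorm_retile.
  by move=> a [].
exact: retile_bounded.
Qed.

Lemma regular_roe_retile :
  set_fun (regular_roe_algebra X) (regular_roe_algebra Y) (retile t u).
Proof.
apply: norm_closure_retile; first exact: regular_norm_retile.
  by move=> a [[]].
exact: regular_retile.
Qed.

Lemma roe_bounded_retile :
  bounded_on (roe_algebra X) opnorm opnorm (retile (v := complex_abs R) t u).
Proof.
have [C _ HC] := opnorm_retile (complex_abs R) t u.
by exists C => a [[al _] _]; exact: HC.
Qed.

Lemma regular_roe_continuous_retile :
  continuous_on (regular_roe_algebra X) regular_norm regular_norm
    (retile (v := complex_abs R) t u).
Proof.
have [C C0 HC] := regular_norm_retile (R := R) t u.
move=> a [[[al _] _ _] _] e e0; have C1 : 0 < C + 1 by rewrite ltr_wpDl.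
exists (e / (C + 1)); first exact: divr_gt0.
move=> b [[[bl _] _ _] _] abe; rewrite -retileB.
apply: le_lt_trans (HC _ (linearB_op bl al)) _.
exact: mulr_small.
Qed.

End OneSide.

Context {X Y : metricType R} (t : tiling B X) (u : tiling B Y).
Hypotheses (tu : controlled t u) (ut : controlled u t).

Theorem tiling_ordered_isomorphic :
  ordered_banach_isomorphic (roe_algebra X) (roe_algebra Y).
Proof.
exists (retile t u), (retile u t); split.
- split; [exact: roe_retile|exact: roe_retile| |].
  + by move=> a [[al _] _]; exact: retileK.
  + by move=> a [[al _] _]; exact: retileK.
- by move=> c a b _ _; exact: retileP.
- by split; exact: roe_bounded_retile.
- by move=> a _; exact: retile_positive.
- by move=> a _; exact: retile_positive.
Qed.

Theorem tiling_lattice_isomorphic :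
  banach_lattice_isomorphic (regular_roe_algebra X) (regular_roe_algebra Y).
Proof.
exists (retile t u), (retile u t); split.
- split; [exact: regular_roe_retile|exact: regular_roe_retile| |].
  + by move=> a [[[al _] _ _] _]; exact: retileK.
  + by move=> a [[[al _] _ _] _]; exact: retileK.
- by move=> c a b _ _; exact: retileP.
- exact: regular_roe_continuous_retile.
- exact: regular_roe_continuous_retile.
- by move=> a [[[al _] _ _] _]; rewrite modulus_retile// complexify_retile.
Qed.

End Isomorphism.

(** * Geometry of the eight rays of the star *)

Notation rays := (bool * bool * bool)%type.

(** The first bit is the sign; the other two select the horizontal axis, the vertical axis, the
    diagonal or the antidiagonal. *)
Definition ray_dir (r : rays) : int * int :=
  let s : int := if r.1.1 then -1 else 1 in
  match r.1.2, r.2 with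
  | false, false => (s, 0)
  | false, true => (0, s)
  | true, false => (s, s)
  | true, true => (s, - s)
  end.

(* The origin belongs to the ray [(false, false, false)] only. *)
Definition ray_pos (r : rays) (n : nat) : nat :=
  (r != (false, false, false)) + n.

Definition ray_pt (r : rays) (n : nat) : int * int :=
  ((ray_pos r n)%:Z * (ray_dir r).1, (ray_pos r n)%:Z * (ray_dir r).2).

(** An integer-valued substitute for the Euclidean metric, equivalent to it and within reach of
    linear arithmetic. *)
Definition l1dist (p q : int * int) : int := `|p.1 - q.1| + `|p.2 - q.2|.

Lemma l1dist_triangle p q w : l1dist p q <= l1dist p w + l1dist w q.
Proof. rewrite /l1dist; lia. Qed.

Lemma in_star_ray r n : in_star (ray_pt r n).
Proof.
by case: r => [[[] []] []];
  rewrite /in_star /ray_pt /= ?mulr0 ?mulrN ?eqxx ?orbT.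
Qed.

Lemma ray_pt_inj r r' n n' : ray_pt r n = ray_pt r' n' -> r = r' /\ n = n'.
Proof.
by case: r => [[[] []] []]; case: r' => [[[] []] []];
  rewrite /ray_pt /ray_pos /= => -[]; (try by move=> *; split=> //; lia); lia.
Qed.

Lemma ray_pt_surj p : in_star p -> exists r n, ray_pt r n = p.
Proof.
case: p => a b; rewrite /in_star /=.
(* The premise excludes the origin on all rays but the first, undoing the shift in [ray_pos]. *)
have P r (n : nat) : (r != (false, false, false) <= n)%N ->
    (n%:Z * (ray_dir r).1, n%:Z * (ray_dir r).2) = (a, b) ->
    exists r n, ray_pt r n = (a, b).
  move=> rn <-; exists r, (n - (r != (false, false, false)))%N.
  by rewrite /ray_pt /ray_pos subnKC.
case/or4P => /eqP; [move=> a0; have [b0|b0] := leP 0 b|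
  move=> b0; have [a0|a0] := leP 0 a|move=> ba; have [a0|a0] := leP 0 a|
  move=> ba; have [a0|a0] := leP 0 a].
- have [b00|b00] := eqVneq b 0.
    by apply: (P (false, false, false) `|b|%N) => //=; congr pair; lia.
  by apply: (P (false, false, true) `|b|%N) => /=; [lia|congr pair; lia].
- by apply: (P (true, false, true) `|b|%N) => /=; [lia|congr pair; lia].
- by apply: (P (false, false, false) `|a|%N) => //=; congr pair; lia.
- by apply: (P (true, false, false) `|a|%N) => /=; [lia|congr pair; lia].
- have [a00|a00] := eqVneq a 0.
    by apply: (P (false, false, false) `|a|%N) => //=; congr pair; lia.
  by apply: (P (false, true, false) `|a|%N) => /=; [lia|congr pair; lia].
- by apply: (P (true, true, false) `|a|%N) => /=; [lia|congr pair; lia].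
- have [a00|a00] := eqVneq a 0.
    by apply: (P (false, false, false) `|a|%N) => //=; congr pair; lia.
  by apply: (P (false, true, true) `|a|%N) => /=; [lia|congr pair; lia].
- by apply: (P (true, true, true) `|a|%N) => /=; [lia|congr pair; lia].
Qed.

(** Distinct rays form an angle of at least 45 degrees, so they diverge linearly in both
    positions. *)
Lemma ray_sep r r' n n' : r != r' ->
  (n + n')%:Z <= 3 * l1dist (ray_pt r n) (ray_pt r' n').
Proof.
by case: r => [[[] []] []]; case: r' => [[[] []] []];
  rewrite // /l1dist /ray_pt /ray_pos /= => _; lia.
Qed.

Lemma ray_same r n n' :
  `|n%:Z - n'%:Z| <= l1dist (ray_pt r n) (ray_pt r n') <= 2 * `|n%:Z - n'%:Z|.
Proof.
by case: r => [[[] []] []]; rewrite /l1dist /ray_pt /ray_pos /=; lia.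
Qed.

(** Each point has l1 norm at most twice its position plus 2, the 2 coming from the shift in
    [ray_pos]. *)
Lemma ray_upper r r' n n' :
  l1dist (ray_pt r n) (ray_pt r' n') <= 2 * (n + n')%:Z + 4.
Proof.
by case: r => [[[] []] []]; case: r' => [[[] []] []];
  rewrite /l1dist /ray_pt /ray_pos /=; lia.
Qed.

(** The sup norm of [ray_pt r n] is [ray_pos r n], and it is 1-Lipschitz for [l1dist]. Unlike
    [ray_sep], this allows equal rays. *)
Lemma ray_lower r r' n n' :
  n%:Z <= n'%:Z + 1 + l1dist (ray_pt r n) (ray_pt r' n').
Proof.
by case: r => [[[] []] []]; case: r' => [[[] []] []];
  rewrite /l1dist /ray_pt /ray_pos /=; lia.
Qed.

Section Spaces.
Context {R : realType}.

Definition ray (r : rays) (n : nat) : star R :=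
  exist (fun p => in_star p) (ray_pt r n) (in_star_ray r n).

Lemma ray_inj r r' n n' : ray r n = ray r' n' -> r = r' /\ n = n'.
Proof. by move=> /(congr1 (@proj1_sig _ _)) /ray_pt_inj. Qed.

Lemma ray_surj (p : star R) : exists r n, ray r n = p.
Proof.
have [r [n rn]] := ray_pt_surj (valP p).
by exists r, n; apply: val_inj.
Qed.

Lemma mdist_star_le (p q : star R) : mdist p q <= (l1dist (val p) (val q))%:~R.
Proof.
rewrite [mdist _ _](_ : _ = dist_plane R (val p) (val q))// /dist_plane /l1dist.
set x := _.1 - _.1; set y := _.2 - _.2.
have l0 : (0 : R) <= (`|x| + `|y|)%:~R by rewrite ler0z addr_ge0.
rewrite -(ger0_norm l0) -sqrtr_sqr ler_wsqrtr// -rmorphXn ler_int.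
rewrite -(real_normK (num_real x)) -(real_normK (num_real y)) sqrrD.
by rewrite addrAC lerDl mulrn_wge0// mulr_ge0.
Qed.

Lemma mdist_star_ge (p q : star R) :
  (l1dist (val p) (val q))%:~R <= 2 * mdist p q.
Proof.
rewrite [mdist _ _](_ : _ = dist_plane R (val p) (val q))// /dist_plane /l1dist.
set x := _.1 - _.1; set y := _.2 - _.2.
have l0 : (0 : R) <= (`|x| + `|y|)%:~R by rewrite ler0z addr_ge0.
rewrite -ler_sqr ?nnegrE ?mulr_ge0 ?sqrtr_ge0//.
rewrite exprMn sqr_sqrtr ?ler0z ?addr_ge0 ?sqr_ge0//.
rewrite -(real_normK (num_real x)) -(real_normK (num_real y)) rmorphD/=.
rewrite rmorphD !rmorphXn /=; set u := `|x|%:~R; set w := `|y|%:~R.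
by have := sqr_ge0 (u - w); nra.
Qed.

Lemma int_bound (r : R) :
  exists N : nat, forall z : int, z%:~R <= r -> z <= N%:Z.
Proof.
exists (Num.bound `|r|) => z zr.
rewrite -(ler_int R); apply: le_trans zr _; apply: le_trans (ler_norm r) _.
exact/ltW/archi_boundP.
Qed.

Lemma mdist_line (m n : int) : mdist (m : Zline R) (n : Zline R) = `|m - n|%:~R.
Proof. by []. Qed.

(** [Negz n] is [-(n + 1)], so the two halves partition the integers, with 0 in the nonnegative
    one. *)
Definition half_line (s : bool) (n : nat) : Zline R :=
  if s then Negz n else Posz n.

Lemma half_line_inj s s' n n' :
  half_line s n = half_line s' n' -> s = s' /\ n = n'.
Proof. by case: s; case: s' => // -[->]. Qed.

Lemma half_line_surj z : exists s n, half_line s n = z.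
Proof. by case: z => n; [exists false, n|exists true, n]. Qed.

End Spaces.

(** * Tiling of the star by pairs of rays *)

Section StarTiling.
Context {R : realType}.

Definition star_row (b : rays * rays) (i : nat) : star R := ray b.1 i.
Definition star_col (b : rays * rays) (j : nat) : star R := ray b.2 j.

Let surj (x y : star R) : exists b i j, star_row b i = x /\ star_col b j = y.
Proof.
have [r [i <-]] := ray_surj x; have [r' [j <-]] := ray_surj y.
by exists (r, r'), i, j.
Qed.

Let inj b b' i i' j j' : star_row b i = star_row b' i' ->
  star_col b j = star_col b' j' -> [/\ b = b', i = i' & j = j'].
Proof.
move: b b' => [r s] [r' s'] /ray_inj /= [-> ->] /ray_inj /= [-> ->].
by split.
Qed.

Definition star_tiling : tiling (rays * rays)%type (star R) := Tiling surj inj.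

End StarTiling.

(** * Tiling of the line, and control in both directions *)

Section LineTiling.
Context {R : realType}.

(** Four choices of the first ray and seven of the second give 28 pairs, which label the column
    classes of one off-diagonal block of the line. *)
Definition off_diagonal (s : bool) : seq (rays * rays) :=
  [seq b <- enum {: rays * rays} | (b.1 != b.2) && (b.1.1.1 == s)].

(* The diagonal block of the ray [(s, p, q)] consists of the entries of the
   half-line [s] with row index of parity [p] and column index of parity [q]. *)
Definition line_row (b : rays * rays) (i : nat) : Zline R :=
  let s := b.1.1.1 in
  if b.1 == b.2 then half_line s (b.1.1.2 + i.*2) else half_line s i.

(** Off the diagonal, columns are split into residue classes modulo the number of labels, the
    residue being the index of [b] among them. *)
Definition line_col (b : rays * rays) (j : nat) : Zline R :=
  let s := b.1.1.1 in
  if b.1 == b.2 then half_line s (b.1.2 + j.*2)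
  else half_line (~~ s) (j * size (off_diagonal s) + index b (off_diagonal s)).

Lemma mem_off_diagonal b s :
  (b \in off_diagonal s) = (b.1 != b.2) && (b.1.1.1 == s).
Proof. by rewrite mem_filter mem_enum andbT. Qed.

Lemma index_off_diagonal b : b.1 != b.2 ->
  (index b (off_diagonal b.1.1.1) < size (off_diagonal b.1.1.1))%N.
Proof. by move=> b12; rewrite index_mem mem_off_diagonal b12 eqxx. Qed.

(** Positivity allows division by this size; the upper bound gives a control constant independent of
    [s]. *)
Lemma size_off_diagonal s :
  (0 < size (off_diagonal s) <= #|{: rays * rays}|)%N.
Proof.
apply/andP; split.
  rewrite -has_predT; apply/hasP.
  exists ((s, false, false), (s, false, true)) => //.
  by rewrite mem_off_diagonal eqxx andbT; case: s.
by rewrite cardE size_filter count_size.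
Qed.

Let surj (x y : Zline R) : exists b i j, line_row b i = x /\ line_col b j = y.
Proof.
have [s [m <-]] := half_line_surj x; have [s' [n <-]] := half_line_surj y.
have [<-|ss'] := eqVneq s s'.
  exists ((s, odd m, odd n), (s, odd m, odd n)), m./2, n./2.
  by rewrite /line_row /line_col eqxx !odd_double_half.
have /andP[L0 _] := size_off_diagonal s.
(* The remainder of [n] chooses the tile, and the quotient will be the position in it. *)
pose b := nth (s, false, false, (s, false, true)) (off_diagonal s)
  (n %% size (off_diagonal s)).
have bL : b \in off_diagonal s by rewrite mem_nth// ltn_mod.
have := bL; rewrite mem_off_diagonal => /andP[b12 /eqP bs].
exists b, m, (n %/ size (off_diagonal s))%N.
rewrite /line_row /line_col (negPf b12) bs; split=> //.
rewrite index_uniq ?ltn_mod// -?divn_eq; last exact: filter_uniq (enum_uniq _).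
by congr half_line; case: (s) (s') ss' => [] [].
Qed.

Let inj b b' i i' j j' : line_row b i = line_row b' i' ->
  line_col b j = line_col b' j' -> [/\ b = b', i = i' & j = j'].
Proof.
rewrite /line_row /line_col.
case: (eqVneq b.1 b.2) => b12; case: (eqVneq b'.1 b'.2) => b'12;
  move=> /half_line_inj[] e1 e2 /half_line_inj[] e3 e4.
- move: b b' b12 b'12 e1 e2 e3 e4 => [[[s p] q] w] [[[s' p'] q'] w'] /= <- <-.
  by move=> -> e2 _ e4; split; [|lia|lia];
    have [-> ->] : p = p' /\ q = q'
      by move: p p' q q' e2 e4 => [] [] [] []; lia.
(* In a diagonal tile, rows and columns lie on the same half-line; in an off-diagonal one, on
   opposite half-lines. *)
- by move: e3; rewrite -e1; case: (b.1.1.1).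
- by move: e3; rewrite -e1; case: (b.1.1.1).
have iL := index_off_diagonal b12; have := index_off_diagonal b'12.
rewrite -e1 in e4 * => i'L; set L := off_diagonal _ in iL i'L e4.
have L0 : (0 < size L)%N by exact: leq_ltn_trans iL.
(* Uniqueness of Euclidean division: the quotient recovers the position, the remainder the label. *)
have jj : j = j'.
  move: (congr1 (divn^~ (size L)) e4) => /=.
  by rewrite !divnMDl// !divn_small// !addn0.
split=> //; move: e4; rewrite jj => /addnI.
by apply: (index_inj b); rewrite -index_mem.
Qed.

Definition line_tiling : tiling (rays * rays)%type (Zline R) := Tiling surj inj.

Lemma mdist_half_line_opp s m n :
  mdist (half_line s m : Zline R) (half_line (~~ s) n) = (m + n + 1)%:R.
Proof.
rewrite mdist_line -[RHS]/((m + n + 1)%:Z%:~R); congr (_%:~R).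
by case: s; rewrite /half_line /=; lia.
Qed.

Lemma mdist_half_line_same s m n :
  mdist (half_line s m : Zline R) (half_line s n) = `|m%:Z - n%:Z|%:~R.
Proof.
rewrite mdist_line; congr (_%:~R).
by case: s; rewrite /half_line /=; lia.
Qed.

Lemma line_star_controlled : controlled line_tiling star_tiling.
Proof.
move=> r; have [N HN] := int_bound r.
(* Diagonal tiles need [N + 1] and off-diagonal ones [2N + 4]; this constant dominates both. *)
exists (2 * (2 * N%:Z) + 4)%:~R => b i j.
rewrite [tile_row _ _ _]/(line_row b i) [tile_col _ _ _]/(line_col b j) => ijr.
apply: le_trans (mdist_star_le _ _) _; rewrite ler_int.
rewrite [l1dist _ _](_ : _ = l1dist (ray_pt b.1 i) (ray_pt b.2 j))//.
move: ijr; rewrite /line_row /line_col; case: eqVneq => [<-|b12].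
  rewrite mdist_half_line_same => /HN h.
  have /andP[_] := ray_same b.1 i j.
  by move: h; case: (b.1.1.2); case: (b.1.2) => /=; lia.
rewrite mdist_half_line_opp => /(HN (Posz _)) h.
have /andP[L0 _] := size_off_diagonal b.1.1.1.
have : (j <= j * size (off_diagonal b.1.1.1))%N by rewrite leq_pmulr.
have := ray_upper b.1 b.2 i j; move: h; set c := index _ _.
set p := (j * _)%N; move: (c) (p) (l1dist _ _) => c1 p1 d; lia.
Qed.

Lemma star_line_controlled : controlled star_tiling line_tiling.
Proof.
move=> r; have [N HN] := int_bound (2 * r); pose W := #|{: rays * rays}|.
(* Diagonal tiles need [2N + 1]. Off the diagonal [i + j <= 3N], the multiplication by the number of
   labels costs at most [3NW], and the label plus 1 at most [W]. *)
exists (5 * N%:Z + 2 + (3 * N * W)%N%:Z + W%:Z)%:~R => b i j.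
rewrite [tile_row _ _ _]/(ray b.1 i) [tile_col _ _ _]/(ray b.2 j) => ijr.
have {ijr} : (l1dist (ray_pt b.1 i) (ray_pt b.2 j) <= N%:Z).
  apply: HN; apply: le_trans (mdist_star_ge (ray b.1 i) (ray b.2 j)) _.
  by rewrite ler_wpM2l.
rewrite [mdist _ _](_ : _ = mdist (line_row b i) (line_col b j))//.
rewrite /line_row /line_col; case: eqVneq => [<-|b12] h.
  rewrite mdist_half_line_same ler_int.
  have /andP[] := ray_same b.1 i j.
  move: ((3 * N * W)%N) (l1dist _ _) h => Q d.
  by case: (b.1.1.2); case: (b.1.2) => /=; lia.
rewrite mdist_half_line_opp -[leLHS]/((_ : nat)%:Z%:~R) ler_int.
have := index_off_diagonal b12; have := ray_sep i j b12.
have /andP[_] := size_off_diagonal b.1.1.1; rewrite -/W.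
set S := size _; set c := index _ _ => SW ijN cS.
have ij3N : (i + j <= 3 * N)%N.
  by move: (l1dist _ _) h ijN => d; rewrite -lez_nat; lia.
have := leq_mul (leq_trans (leq_addl i j) ij3N) SW.
move: ((3 * N * W)%N) ((j * S)%N) => Q p pQ.
by rewrite lez_nat; move: (W) (S) (c) cS SW pQ => w s e; lia.
Qed.

End LineTiling.

(** * The line and the star are not coarsely equivalent *)

Section NotCoarse.
Context {R : realType}.

Lemma l1dist_bound (r : R) : exists N : nat, forall p q : star R,
  mdist p q <= r -> l1dist (val p) (val q) <= N%:Z.
Proof.
have [N HN] := int_bound (2 * r); exists N => p q pqr.
by apply: HN; apply: le_trans (mdist_star_ge p q) _; rewrite ler_wpM2l.
Qed.

(** Images of neighbouring integers are at l1 distance at most [S]. Far out, all images have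
    position beyond [3 * S], where by [ray_sep] a change of ray would need a longer jump. *)
Lemma coarse_tail (f : Zline R -> star R) : coarse f -> expanding f ->
  exists (N : nat) (e : bool -> rays), forall s n,
  exists k, f (half_line s (N + n)) = ray (e s) k.
Proof.
move=> fc fe.
have /choice[rk fE] z : exists rk, f z = ray rk.1 rk.2.
  by have [r [k <-]] := ray_surj (f z); exists (r, k).
have [s1 _ Hs1] := fc 2 (ltr0Sn _ _); have [S HS] := l1dist_bound s1.
have step z z' : mdist z z' < 2 -> l1dist (val (f z)) (val (f z')) <= S%:Z.
  by move=> /Hs1/ltW/HS.
pose z0 : Zline R := half_line false 0.
(* By [ray_upper], a point farther than [D] from the image of [z0] has position beyond [3 * S]. *)
pose D := (6 * S + 2 * (rk z0).2 + 5)%N.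
have D0 : (0 : R) < D%:R by rewrite ltr0n /D addnS.
have [r _ Hr] := fe _ D0; have [N HN] := int_bound r.
have far s n : (3 * S < (rk (half_line s (N.+1 + n))).2)%N.
  set z := half_line s _.
  have /Hr : r < mdist z z0.
    rewrite ltNge; apply/negP => h.
    have := HN `|z - z0| h; rewrite /z /z0 /half_line.
    by case: (s); lia.
  move=> /lt_le_trans /(_ (mdist_star_le _ _)).
  rewrite -[ltLHS]/(D%:Z%:~R) ltr_int !fE.
  have := ray_upper (rk z).1 (rk z0).1 (rk z).2 (rk z0).2.
  rewrite [l1dist (val _) _](_ : _ = l1dist (ray_pt (rk z).1 (rk z).2)
    (ray_pt (rk z0).1 (rk z0).2))//.
  by move: (l1dist _ _) => d; rewrite /D; lia.
exists N.+1, (fun s => (rk (half_line s (N.+1 + 0))).1) => s n.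
exists (rk (half_line s (N.+1 + n))).2; rewrite fE; congr ray.
elim: n => // n <-; apply/eqP/negPn/negP => ne.
set z := half_line s (N.+1 + n.+1) in ne *.
set z' := half_line s (N.+1 + n) in ne *.
have zz' : mdist z z' < 2.
  rewrite /z /z' mdist_half_line_same -[ltRHS]/(2%:~R) ltr_int; lia.
have := step _ _ zz'; rewrite !fE.
rewrite [l1dist _ _](_ : _ = l1dist (ray_pt (rk z).1 (rk z).2)
    (ray_pt (rk z').1 (rk z').2))//.
have := ray_sep (rk z).2 (rk z').2 ne; have := far s n.+1; have := far s n.
rewrite -/z -/z'; move: (l1dist _ _) => d; lia.
Qed.

(** Handles the finitely many integers left out by [coarse_tail]. *)
Lemma coarse_bounded (f : Zline R -> star R) (N : nat) : coarse f ->
  exists M : nat, forall s n, (n < N)%N ->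
  l1dist (val (f (half_line s n))) (val (f (half_line false 0))) <= M%:Z.
Proof.
move=> fc; have [s0 _ Hs0] := fc N.+2%:R (ltr0Sn _ _).
have [M HM] := l1dist_bound s0; exists M => s n nN.
apply/HM/ltW/Hs0; rewrite mdist_line -[ltRHS]/(N.+2%:Z%:~R) ltr_int.
by rewrite /half_line; case: (s); lia.
Qed.

Lemma cobounded_image (f : Zline R -> star R) :
  (ereal_sup (range (dist_to_image f)) < +oo)%E ->
  exists M : nat, forall y : star R, exists z,
  l1dist (val y) (val (f z)) <= M%:Z.
Proof.
move=> fs.
(* The distance to the image is an infimum; a radius strictly above the supremum is undercut by an
   actual image point. *)
have [r Hr] : exists r : R, (ereal_sup (range (dist_to_image f)) < r%:E)%E.
  case: ereal_sup fs => [r| |]// _; last by exists 0; rewrite ltNyr.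
  by exists (r + 1); rewrite lte_fin ltrDl.
have [M HM] := l1dist_bound r; exists M => y.
have : (dist_to_image f y < r%:E)%E.
  by apply: le_lt_trans Hr; apply: ereal_sup_ubound; exists y.
move=> /ereal_inf_lt[_ [z _ <-]]; rewrite lte_fin => /ltW/HM h.
by exists z.
Qed.

Lemma third_ray (e : bool -> rays) : exists r, forall s, r != e s.
Proof.
have : exists r, (r != e true) && (r != e false).
  case: (e true) (e false) => [[[] []] []] [[[] []] []];
  solve [by exists (true, true, true) | by exists (true, true, false)
        | by exists (true, false, true)].
by move=> [r /andP[rt rf]]; exists r => -[].
Qed.

Lemma line_star_not_coarsely_equivalent :
  ~ coarsely_equivalent (Zline R) (star R).
Proof.
move=> [f [fc fe fs]].
have [N [e tail]] := coarse_tail fc fe.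
have [M1 HM1] := coarse_bounded N fc; have [M2 HM2] := cobounded_image fs.
have [r er] := third_ray e.
have [r0 [k0 f0]] := ray_surj (f (half_line false 0)).
(* This point of the uncovered ray is too far out on two counts: its position exceeds
   [k0 + 1 + M1 + M2], which [ray_lower] excludes for the middle part of the line, and [3 * M2],
   which [ray_sep] excludes for the tails. *)
have [z] := HM2 (ray r (3 * M2 + M1 + k0 + 2)).
have [s [n <-]] := half_line_surj z.
have [nN|Nn] := ltnP n N.
  move=> near; have := HM1 s n nN; rewrite -f0 => /(lerD near) h.
  have := le_trans (l1dist_triangle _ _ _) h.
  rewrite [l1dist _ _](_ : _ = l1dist (ray_pt r (3 * M2 + M1 + k0 + 2))
    (ray_pt r0 k0))//.
  have := ray_lower r r0 (3 * M2 + M1 + k0 + 2) k0.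
  by move: (l1dist _ _) => d; lia.
have [k ->] : exists k, f (half_line s n) = ray (e s) k.
  by rewrite -(subnKC Nn); exact: tail.
have := ray_sep (3 * M2 + M1 + k0 + 2) k (er s).
rewrite [X in _ -> X <= _ -> _](_ : _ = l1dist
  (ray_pt r (3 * M2 + M1 + k0 + 2)) (ray_pt (e s) k))//.
move: (l1dist _ _) => d; lia.
Qed.

End NotCoarse.

Theorem theorem5p2 (R : realType) :
  [/\ ~ coarsely_equivalent (Zline R) (star R),
      ordered_banach_isomorphic (roe_algebra (Zline R)) (roe_algebra (star R))
    & banach_lattice_isomorphic (regular_roe_algebra (Zline R))
        (regular_roe_algebra (star R))].
Proof.
split; first exact: line_star_not_coarsely_equivalent.
- exact: tiling_ordered_isomorphic line_star_controlled star_line_controlled.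
- exact: tiling_lattice_isomorphic line_star_controlled star_line_controlled.
Qed.
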